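(* Let $S_k$ denote the subset of sensors selected by the randomized greedy algorithm at time $k$ with parameters $K$ and $\epsilon$, $e^{-K}\le\epsilon<1$; let $O_k$ be the optimum solution, with $|O_k|=K$, of $\max f(S)$ subject to $S\subset[n]$, $|S|=K$; and let $c=\max\{\mathcal{C}_{\max},1\}$, where $\mathcal{C}_{\max}$ is the maximum element-wise curvature of $f$. Let $\{\eta_k^{(i)}\}_{i=1}^K$ denote the collection of random variables given by the ratios of the marginal gains of the randomized greedy and greedy selections (defined in the context), such that $0<\ell_i(\epsilon)\le\eta_k^{(i)}\le1$ and $\mathbb{E}[\eta_k^{(i)}]=\mu_i(\epsilon)$ for all $i$ and $k$. Let $\ell_{\min}(\epsilon)=\min_{i,k}\{\ell_i(\epsilon)\}$ and $\mu_{\min}(\epsilon)=\min_{i,k}\{\mu_i(\epsilon)\}$. Then $$f(S_k)\ge\left(1-e^{-\frac{\ell_{\min}(\epsilon)}{c}}\right)f(O_k).$$ Furthermore, if $\{\eta_k^{(i)}\}_{i=1}^K$ are independent, then for all $0<q<1$, with probability at least $1-e^{-CK}$, it holds that $$f(S_k)\ge\left(1-e^{-\frac{(1-q)\mu_{\min}(\epsilon)}{c}}\right)f(O_k),$$ for some $C>0$.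
   Context: Let $[n]=\{1,\dots,n\}$ index the sensors. At each time step $k$ one is given (dependence on $k$ suppressed) a symmetric positive definite $\mathbf{P}\in\mathbb{R}^{m\times m}$ (the Kalman filter's predicted error covariance $\mathbf{P}_{k|k-1}$), measurement (column) vectors $\mathbf{h}_1,\dots,\mathbf{h}_n\in\mathbb{R}^m$, and noise variances $\sigma_1^2,\dots,\sigma_n^2>0$. For $S\subseteq[n]$, $$\mathbf{F}_S=\mathbf{P}^{-1}+\sum_{i\in S}\sigma_i^{-2}\mathbf{h}_i\mathbf{h}_i^\top,\qquad f(S)=\mathrm{Tr}(\mathbf{P}-\mathbf{F}_S^{-1}),\qquad f_i(S)=f(S\cup\{i\})-f(S).$$ Element-wise curvature: $$\mathcal{C}_l=\max_{(S,T,i)\in\mathcal{X}_l}\frac{f_i(T)}{f_i(S)},\qquad \mathcal{X}_l=\{(S,T,i): S\subset T\subset[n],\ i\in[n]\setminus T,\ |T\setminus S|=l\},$$ and $\mathcal{C}_{\max}=\max_l\mathcal{C}_l$. Randomized greedy algorithm: start with $S_k^{(0)}=\emptyset$. In iteration $i=1,\dots,K$: choose $R$ by sampling $s=\frac nK\log(1/\epsilon)$ indices uniformly at random, without replacement, from $[n]\setminus S_k^{(i-1)}$ (for $\epsilon=e^{-K}$, $R$ consists of all non-selected sensors); let $i_{rg}=\arg\max_{j\in R}f_j(S_k^{(i-1)})$ and set $S_k^{(i)}=S_k^{(i-1)}\cup\{i_{rg}\}$. Output $S_k=S_k^{(K)}$. The greedy rule at the same current set selects $i_g=\arg\max_{j\in[n]\setminus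 S_k^{(i-1)}}f_j(S_k^{(i-1)})$. The random variables $\eta_k^{(i)}$ are defined by $$f_{i_{rg}}(S_k^{(i-1)})=\eta_k^{(i)}f_{i_g}(S_k^{(i-1)}).$$ The bounds $\ell_i(\epsilon)$ and means $\mu_i(\epsilon)$ may vary with the time $k$; the time index is omitted for simplicity. *)

(* Defs.v *)
(* MathComp / MathComp-Analysis. *)
From HB Require Import structures.
From mathcomp Require Import all_boot all_order all_algebra.
From mathcomp Require Import all_classical all_reals all_analysis.

Set Implicit Arguments.
Unset Strict Implicit.
Unset Printing Implicit Defensive.

Import Order.TTheory GRing.Theory Num.Theory.
Import numFieldNormedType.Exports.

Local Open Scope classical_set_scope.
Local Open Scope ring_scope.

Definition sympd (R : realType) (m : nat) (A : 'M[R]_m) : Prop :=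
  A^T = A /\ forall x : 'cV[R]_m, x != 0 -> 0 < (x^T *m A *m x) 0 0.

Definition is_argmax (R : realType) (I : finType) (A : {set I}) (F : I -> R)
    (i : I) : Prop :=
  i \in A /\ forall j, j \in A -> F j <= F i.

Definition is_min (R : realType) (I : Type) (F : I -> R) (x : R) : Prop :=
  (exists i, F i = x) /\ forall i, x <= F i.

Section Objective.
Context {R : realType} {m n : nat}.
Variables (P : 'M[R]_m) (h : 'I_n -> 'cV[R]_m).
(* [sigma2 i] is the variance $\sigma_i^2$, not its square root. *)
Variable sigma2 : 'I_n -> R.

Definition information (S : {set 'I_n}) : 'M[R]_m :=
  invmx P + \sum_(i in S) (sigma2 i)^-1 *: (h i *m (h i)^T).

Definition mse_reduction (S : {set 'I_n}) : R :=
  \tr (P - invmx (information S)).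

End Objective.

Section SetFunction.
Context {R : realType} {n : nat}.
Variable f : {set 'I_n} -> R.

Definition marginal_gain (S : {set 'I_n}) (i : 'I_n) : R := f (i |: S) - f S.

Definition curvature_dom (l : nat) (x : {set 'I_n} * {set 'I_n} * 'I_n) : bool :=
  let: (A, B, i) := x in [&& A \subset B, i \notin B & #|B :\: A| == l].

(* The neutral element 0 of the maximum only matters for an empty domain when f
   is nondecreasing, as all ratios are then nonnegative.  A ratio 0 / 0 is 0. *)
Definition curvature (l : nat) : R :=
  \big[Num.max/0]_(x : {set 'I_n} * {set 'I_n} * 'I_n | curvature_dom l x)
    (let: (A, B, i) := x in marginal_gain B i / marginal_gain A i).

Definition max_curvature : R := \big[Num.max/0]_(1 <= l < n) curvature l.

Definition is_optimum (K : nat) (O : {set 'I_n}) : Prop :=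
  is_argmax [set S : {set 'I_n} | #|S| == K]%SET f O.

End SetFunction.

(* Set obtained after i iterations.  Iterations are numbered from 0, so that
   [sel i] is the index added to [selected sel i]. *)
Fixpoint selected (n : nat) (sel : nat -> 'I_n) (i : nat) : {set 'I_n} :=
  if i is j.+1 then sel j |: selected sel j else finset.set0.

(* $\frac nK\log(1/\epsilon)$ is rounded up, hence positive for eps < 1, and
   capped by the number of indices that are still available. *)
Definition sample_size (R : realType) (n K : nat) (eps : R) (S : {set 'I_n}) :
    nat :=
  minn `|Num.ceil (n%:R / K%:R * ln (1 / eps))|%N #|~: S|.

Section RandomizedGreedy.
Context {R : realType} {d : measure_display} {Omega : measurableType d}.
Variable Pr : probability Omega R.

Definition past (n : nat) (smp : Omega -> nat -> {set 'I_n})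
    (sel : Omega -> nat -> 'I_n) (i : nat)
    (smp0 : nat -> {set 'I_n}) (sel0 : nat -> 'I_n) : set Omega :=
  [set w | forall j, (j < i)%N -> smp w j = smp0 j /\ sel w j = sel0 j].

(* A run of the algorithm at one time step: [smp w i] is the sampled set R and
   [sel w i] the selected index of iteration i.  [rg_uniform] says that, given
   the past of the run, the sample is uniform among the sets of the prescribed
   size.  Ties in the argmax may be broken in any, even random, way. *)
Record randomized_greedy (n K : nat) (eps : R) (f : {set 'I_n} -> R)
    (smp : Omega -> nat -> {set 'I_n}) (sel : Omega -> nat -> 'I_n) : Prop := {
  rg_smp_measurable : forall i A, (i < K)%N ->
    measurable [set w | smp w i = A] ;
  rg_sel_measurable : forall i j, (i < K)%N ->
    measurable [set w | sel w i = j] ;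
  rg_smp_sub : forall w i, (i < K)%N ->
    smp w i \subset ~: selected (sel w) i ;
  rg_smp_card : forall w i, (i < K)%N ->
    #|smp w i| = sample_size K eps (selected (sel w) i) ;
  rg_uniform : forall (i : nat) (smp0 : nat -> {set 'I_n})
      (sel0 : nat -> 'I_n) (A : {set 'I_n}), (i < K)%N ->
    let S := selected sel0 i in
    A \subset ~: S -> #|A| = sample_size K eps S ->
    Pr ([set w | smp w i = A] `&` past smp sel i smp0 sel0) =
      ((('C(#|~: S|, sample_size K eps S))%:R^-1 : R)%:E
         * Pr (past smp sel i smp0 sel0))%E ;
  rg_argmax : forall w i, (i < K)%N ->
    is_argmax (smp w i) (marginal_gain f (selected (sel w) i)) (sel w i)
}.

(* $f_{i_{rg}}(S) = \eta f_{i_g}(S)$, whichever greedy index g is taken. *)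
Definition is_gain_ratio (n K : nat) (f : {set 'I_n} -> R)
    (sel : Omega -> nat -> 'I_n) (eta : 'I_K -> Omega -> R) : Prop :=
  forall (w : Omega) (i : 'I_K) (g : 'I_n),
    let S := selected (sel w) i in
    is_argmax (~: S) (marginal_gain f S) g ->
    marginal_gain f S (sel w i) = eta i w * marginal_gain f S g.

Definition mutually_independent (I : finType) (X : I -> Omega -> R) : Prop :=
  forall (J : {set I}) (B : I -> set R), (forall i, measurable (B i)) ->
    Pr (\bigcap_(i in [set` J]) (X i @^-1` B i)) =
      (\prod_(i in J) Pr (X i @^-1` B i))%E.

End RandomizedGreedy.

(* Main.v *)
(* With F the information matrix of S, the Sherman-Morrison formula gives
   f_i(S) = |F^-1 h_i|^2 / (sigma_i^2 + h_i^T F^-1 h_i), so f is monotone, and a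
   gain vanishes only if h_i = 0.  Adding the elements of O to the current set S
   one by one yields f(O) - f(S) <= c K f_g(S) for the greedy index g; hence the
   gap f(O) - f(S) shrinks by a factor 1 - eta_i / (c K) in iteration i, and
   f(O) - f(S_K) <= exp(- (sum_i eta_i) / (c K)) f(O).  The first bound follows
   from eta_i >= l_min, the second from a Chernoff bound for the lower tail of
   sum_i eta_i.  To use only the product rule for events, each eta_i is rounded
   down to a multiple of 1/N with 1/N <= q^2 mu_min / 2; the exponential moments
   are then finite sums, and the exponential parameter q gives the rate
   q^3 mu_min / (2 (1 + q)). *)
Require Import Defs.
From HB Require Import structures.
From mathcomp Require Import all_boot all_order all_algebra.
From mathcomp Require Import all_classical all_reals all_analysis.
From mathcomp Require Import ring lra.

Set Implicit Arguments.
Unset Strict Implicit.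
Unset Printing Implicit Defensive.

Import Order.TTheory GRing.Theory Num.Theory.
Import numFieldNormedType.Exports.

Local Open Scope classical_set_scope.
Local Open Scope ring_scope.

(** * Positive definite matrices and rank-one updates *)

Lemma sympd_unitmx (R : realType) (m : nat) (A : 'M[R]_m) :
  sympd A -> A \in unitmx.
Proof.
move=> [_ Apos]; rewrite -row_free_unit -kermx_eq0; apply/rowV0P => v /sub_kermxP vA.
apply/eqP; apply: contraT => v0.
have /Apos : v^T != 0 by rewrite trmx_eq0.
by rewrite trmxK vA mul0mx mxE ltxx.
Qed.

Lemma sympd_invmx (R : realType) (m : nat) (A : 'M[R]_m) :
  sympd A -> sympd (invmx A).
Proof.
move=> Apd; have uA := sympd_unitmx Apd; case: Apd => Asym Apos.
split=> [|x x0]; first by rewrite trmx_inv Asym.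
have := Apos (invmx A *m x); rewrite trmx_mul trmx_inv Asym -!mulmxA mulKVmx //.
rewrite mulmxA; apply; apply: contra x0 => /eqP x0.
by rewrite -(mulKVmx uA x) x0 mulmx0.
Qed.

Lemma quad_outer_ge0 (R : realType) (m : nat) (h x : 'cV[R]_m) :
  0 <= (x^T *m (h *m h^T) *m x) 0 0.
Proof.
have -> : x^T *m (h *m h^T) *m x = (h^T *m x)^T *m (h^T *m x).
  by rewrite trmx_mul trmxK !mulmxA.
rewrite mxE sumr_ge0 // => i _; rewrite !mxE; exact: sqr_ge0.
Qed.

Lemma information_sympd (R : realType) (m n : nat) (P : 'M[R]_m)
    (h : 'I_n -> 'cV[R]_m) (sigma2 : 'I_n -> R) (S : {set 'I_n}) :
  sympd P -> (forall i, 0 < sigma2 i) -> sympd (information P h sigma2 S).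
Proof.
move=> Ppd s0; have [Isym Ipos] := sympd_invmx Ppd.
(* The sum over [S] may be empty or degenerate, so only semidefiniteness passes through it;
   strictness comes from [invmx P] alone. *)
pose psd (B : 'M[R]_m) := B^T = B /\ forall x : 'cV_m, 0 <= (x^T *m B *m x) 0 0.
have [Bsym Bpos] : psd (\sum_(i in S) (sigma2 i)^-1 *: (h i *m (h i)^T)).
  apply: (big_ind psd) => [|A B [As Ap] [Bs Bp]|i _].
  - by split=> [|x]; rewrite ?trmx0 ?mulmx0 ?mul0mx ?mxE.
  - split=> [|x]; first by rewrite raddfD /= As Bs.
    by rewrite mulmxDr mulmxDl mxE addr_ge0.
  - split=> [|x]; first by rewrite linearZ /= trmx_mul trmxK.
    rewrite -scalemxAr -scalemxAl mxE mulr_ge0 ?invr_ge0 ?(ltW (s0 _)) //.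
    exact: quad_outer_ge0.
split=> [|x x0]; first by rewrite raddfD /= Isym Bsym.
by rewrite mulmxDr mulmxDl mxE ltr_wpDr // Ipos.
Qed.

(** The [?= iff] form keeps the equality case, which later decides which gains vanish. *)
Lemma mulmx_tr_col_ge0 (R : realType) (m : nat) (v : 'cV[R]_m) :
  0 <= (v^T *m v) 0 0 ?= iff (v == 0).
Proof.
rewrite mxE; under eq_bigr do rewrite mxE -expr2.
split; first by rewrite sumr_ge0 // => i _; exact: sqr_ge0.
rewrite eq_sym psumr_eq0 => [|i _]; last exact: sqr_ge0.
apply/allP/eqP => [v0|-> i _]; last by rewrite mxE expr0n eqxx.
apply/matrixP => i j; rewrite mxE ord1; apply/eqP.
by have /= := v0 i; rewrite mem_index_enum sqrf_eq0; apply.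
Qed.

Lemma Sherman_Morrison (R : realType) (m : nat) (A : 'M[R]_m) (h : 'cV[R]_m)
    (a : R) (u := invmx A *m h) :
  A^T = A -> A \in unitmx -> A + a *: (h *m h^T) \in unitmx ->
  1 + a * (h^T *m u) 0 0 != 0 ->
  invmx (A + a *: (h *m h^T)) =
    invmx A - (a / (1 + a * (h^T *m u) 0 0)) *: (u *m u^T).
Proof.
move=> Asym uA uB d0.
set b := _ / _; set B := A + _.
suff E : B *m (invmx A - b *: (u *m u^T)) = 1%:M.
  by rewrite -[RHS](mulKmx uB) E mulmx1.
have uT : u^T = h^T *m invmx A by rewrite trmx_mul trmx_inv Asym.
rewrite mulmxBr !mulmxDl mulmxV // -!scalemxAl -!scalemxAr.
have -> : A *m (u *m u^T) = h *m u^T by rewrite mulmxA mulKVmx.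
have -> : h *m h^T *m (u *m u^T) = (h^T *m u) 0 0 *: (h *m u^T).
  rewrite -mulmxA [h^T *m _]mulmxA [h^T *m u]mx11_scalar mul_scalar_mx.
  by rewrite -scalemxAr -mx11_scalar.
rewrite -mulmxA -uT !scalerA -scalerDl -addrA -scalerBl.
(* Apart from the identity, every term of the product is a multiple of [h *m u^T]; [k] collects the
   coefficients, and [b] is chosen to make it 0. *)
set k := _ - _; suff -> : k = 0 by rewrite scale0r addr0.
by rewrite /k /b; field.
Qed.

(** * Marginal gains of the objective *)

Section Gain.
Context (R : realType) (m n : nat) (P : 'M[R]_m) (h : 'I_n -> 'cV[R]_m).
Variable sigma2 : 'I_n -> R.
Hypotheses (Ppd : sympd P) (sigma2_gt0 : forall i, 0 < sigma2 i).
Local Notation f := (mse_reduction P h sigma2).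

Lemma mse_reduction_set0 : f finset.set0 = 0.
Proof. by rewrite /mse_reduction /information big_set0 addr0 invmxK subrr mxtrace0. Qed.

(** By the rank-one update, the gain is a positive multiple of the squared norm of [invmx F *m h i].
    The equality case does not mention [S]: a gain that vanishes at one set without [i] vanishes at
    all of them, which is what [gain_eq0] asks for below. *)
Lemma mse_reduction_gain_ge0 (S : {set 'I_n}) (i : 'I_n) : i \notin S ->
  0 <= marginal_gain f S i ?= iff (h i == 0).
Proof.
move=> iS; have Fpd := information_sympd h S Ppd sigma2_gt0.
have := sympd_unitmx (information_sympd h (i |: S) Ppd sigma2_gt0).
rewrite /marginal_gain /mse_reduction.
have -> : information P h sigma2 (i |: S) =
    information P h sigma2 S + (sigma2 i)^-1 *: (h i *m (h i)^T).
  by rewrite /information big_setU1 //= addrCA addrC.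
move: (information _ _ _ S) Fpd => F Fpd uG; have uF := sympd_unitmx Fpd.
have := sigma2_gt0 i; rewrite -invr_gt0.
move: (h i) (sigma2 i)^-1 uG => v a uG a0.
have uFv0 : (invmx F *m v == 0) = (v == 0).
  apply/eqP/eqP => [Fv0|->]; last by rewrite mulmx0.
  by rewrite -(mulKVmx uF v) Fv0 mulmx0.
have q0 : 0 <= (v^T *m (invmx F *m v)) 0 0.
  have [->|v0] := eqVneq v 0; first by rewrite !mulmx0 mxE.
  by have [_ /(_ _ v0) /ltW] := sympd_invmx Fpd; rewrite mulmxA.
have d0 : 0 < 1 + a * (v^T *m (invmx F *m v)) 0 0.
  by rewrite ltr_wpDr // mulr_ge0 // ltW.
rewrite (Sherman_Morrison Fpd.1 uF uG (lt0r_neq0 d0)).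
move: (invmx F *m v) d0 uFv0 => u d0 <-.
set b := a / _; have b0 : 0 < b by rewrite divr_gt0.
rewrite (_ : _ - _ = b * (u^T *m u) 0 0); last first.
  by rewrite !raddfB /= linearZ /= mxtrace_mulC trace_mx11; ring.
have [t0 tE] := mulmx_tr_col_ge0 u.
split; first by rewrite mulr_ge0 // ltW.
by rewrite eq_sym mulf_eq0 (gt_eqF b0) /= eq_sym tE.
Qed.

End Gain.

(** * Element-wise curvature and the greedy recursion *)

Lemma superset_ind (T : finType) (S : {set T}) (Q : {set T} -> Prop) :
  Q S ->
  (forall (A : {set T}) i, S \subset A -> i \notin A -> Q A -> Q (i |: A)) ->
  forall B : {set T}, S \subset B -> Q B.
Proof.
move=> QS Qstep B; move k : #|B :\: S| => l.
elim: l B k => [|l IHl] B.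
  move=> /eqP; rewrite cards_eq0 finset.setD_eq0 => BS SB.
  by have -> : B = S by apply/eqP; rewrite finset.eqEsubset BS.
move=> k SB; have /card_gt0P[i iBS] : (0 < #|B :\: S|)%N by rewrite k.
have := iBS; rewrite finset.inE => /andP[iS iB].
rewrite -(finset.setD1K iB); apply: Qstep; first by rewrite subsetD1 SB.
  by rewrite !finset.inE eqxx.
apply: IHl; last by rewrite subsetD1 SB.
have := cardsD1 i (B :\: S); rewrite k iBS => -[->].
by congr #|pred_of_set _|; apply/finset.setP => x; rewrite !finset.inE andbCA.
Qed.

Section Curvature.
Context (R : realType) (n : nat) (f : {set 'I_n} -> R).
Hypothesis gain_ge0 : forall (S : {set 'I_n}) i, i \notin S ->
  0 <= marginal_gain f S i.

Lemma monotone_of_gain_ge0 (S T : {set 'I_n}) : S \subset T -> f S <= f T.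
Proof.
move: T; apply: superset_ind => // A i _ iA fSA.
by apply: le_trans fSA _; rewrite -subr_ge0; exact: gain_ge0.
Qed.

(* A vanishing gain must stay zero, because of the convention x / 0 = 0 in the
   curvature. *)
Hypothesis gain_eq0 : forall (S T : {set 'I_n}) i, S \subset T -> i \notin T ->
  marginal_gain f S i = 0 -> marginal_gain f T i = 0.
Local Notation c := (Num.max (max_curvature f) 1).

(** If the gain at [S] is nonzero and [T] differs from [S], the ratio is one of those in the
    maximum. The case [T = S] is not covered by [max_curvature], whose index starts at 1; there the
    1 in [c] serves. *)
Lemma marginal_gain_curvature (S T : {set 'I_n}) (i : 'I_n) :
  S \subset T -> i \notin T -> marginal_gain f T i <= c * marginal_gain f S i.
Proof.
move=> ST iT; have iS : i \notin S by apply: contra iT; apply: (fintype.subsetP ST).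
have gS := gain_ge0 iS.
have [g0|gn0] := eqVneq (marginal_gain f S i) 0.
  by rewrite g0 mulr0 (gain_eq0 ST iT g0).
have [TS0|TSn0] := eqVneq #|T :\: S| 0%N.
  have -> : T = S.
    apply/eqP; rewrite finset.eqEsubset ST andbT -finset.setD_eq0.
    by rewrite -cards_eq0 TS0.
  by rewrite ler_peMl // le_max lexx orbT.
have gSpos : 0 < marginal_gain f S i by rewrite lt_neqAle eq_sym gn0.
rewrite -ler_pdivrMr // le_max; apply/orP; left.
(* [max_curvature] only ranges over [l < n]; the index [i] outside [T] gives the strict
   inequality. *)
have TSn : (#|T :\: S| < n)%N.
  rewrite -[X in (_ < X)%N]card_ord -cardsT; apply: proper_card.
  apply/properP; split; first exact: finset.subsetT.
  by exists i; rewrite ?finset.inE // (negPf iT) andbF.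
apply: (@le_trans _ _ (curvature f #|T :\: S|)).
  apply: (bigmax_sup (S, T, i)) => //.
  by rewrite /curvature_dom ST iT eqxx.
rewrite /max_curvature.
apply: (Order.TotalTheory.le_bigmax_seq 0 #|T :\: S| xpredT (curvature f)) => //.
by rewrite mem_index_iota lt0n TSn0.
Qed.

Lemma gain_setU_le (S T : {set 'I_n}) :
  f (S :|: T) - f S <= c * \sum_(j in T :\: S) marginal_gain f S j.
Proof.
have c0 : 0 <= c by rewrite le_max ler01 orbT.
(* Now [T] occurs only through [S :|: T], which can be generalized to an arbitrary superset of [S]
   and built up one element at a time. *)
have -> : T :\: S = (S :|: T) :\: S by rewrite finset.setDUl finset.setDv finset.set0U.
move: (S :|: T) (finset.subsetUl S T); apply: superset_ind.
  by rewrite subrr finset.setDv big_set0 mulr0.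
move=> A i SA iA IH; have iS : i \notin S.
  by apply: contra iA; apply: (fintype.subsetP SA).
have -> : (i |: A) :\: S = i |: (A :\: S).
  apply/finset.setP => x; rewrite !finset.inE.
  by case: eqVneq => // ->; rewrite iS.
rewrite big_setU1 /= ?finset.inE ?(negPf iA) ?andbF // mulrDr.
rewrite -[f _](subrK (f A)) -addrA lerD //.
exact: marginal_gain_curvature.
Qed.

Lemma max_gain_ge (S O : {set 'I_n}) (g : 'I_n) :
  is_argmax (~: S)%SET (marginal_gain f S) g ->
  f O - f S <= c * #|O|%:R * marginal_gain f S g.
Proof.
move=> [gS gmax]; have gg0 : 0 <= marginal_gain f S g.
  by apply: gain_ge0; rewrite finset.inE in gS.
have c0 : 0 <= c by rewrite le_max ler01 orbT.
apply: (@le_trans _ _ (f (S :|: O) - f S)).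
  by rewrite lerD2r; apply: monotone_of_gain_ge0; exact: finset.subsetUr.
apply: (le_trans (gain_setU_le S O)); rewrite -mulrA ler_wpM2l //.
apply: (@le_trans _ _ (\sum_(j in O :\: S) marginal_gain f S g)).
  apply: ler_sum => j; rewrite finset.inE => /andP[jS _].
  by apply: gmax; rewrite finset.inE.
rewrite sumr_const -[X in X <= _]mulr_natl ler_wpM2r // ler_nat.
by apply: subset_leq_card; exact: finset.subsetDl.
Qed.

Lemma card_selected (sel : nat -> 'I_n) (i : nat) : (#|selected sel i| <= i)%N.
Proof.
elim: i => [|i IHi] /=; first by rewrite cards0.
by rewrite cardsU1 -add1n leq_add // leq_b1.
Qed.

Lemma argmax_exists (A : {set 'I_n}) (F : 'I_n -> R) :
  (0 < #|A|)%N -> exists i, is_argmax A F i.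
Proof.
case/card_gt0P => i0 i0A; exists [arg max_(i > i0 in A) F i]%O.
by case: arg_maxP => // i iA imax; split=> // j jA; exact: imax.
Qed.

Hypothesis f0 : f finset.set0 = 0.

(** A deterministic statement about a single run, with [x] any lower bound for the average of [eta];
    it thus serves both the worst-case and the probabilistic claim. *)
Lemma greedy_bound (K : nat) (O : {set 'I_n}) (sel : nat -> 'I_n)
    (eta : 'I_K -> R) (x : R) :
  (0 < K)%N -> #|O| = K ->
  (forall (i : 'I_K) g, let S := selected sel i in
    is_argmax (~: S)%SET (marginal_gain f S) g ->
    marginal_gain f S (sel i) = eta i * marginal_gain f S g) ->
  (forall i, 0 <= eta i <= 1) ->
  x * K%:R <= \sum_i eta i ->
  (1 - expR (- (x / c))) * f O <= f (selected sel K).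
Proof.
move=> K0 OK geta eta01 xeta.
have c1 : 1 <= c by rewrite le_max lexx orbT.
have c0 : 0 < c by apply: lt_le_trans c1.
have cK0 : 0 < c * K%:R by rewrite mulr_gt0 // ltr0n.
have fO0 : 0 <= f O by rewrite -f0; apply: monotone_of_gain_ge0; exact: finset.sub0set.
have step i : (i <= K)%N ->
    f O - f (selected sel i) <=
      expR (- ((\sum_(j < K | (j < i)%N) eta j) / (c * K%:R))) * f O.
  elim: i => [_|i IHi iK].
    by rewrite /= f0 subr0 big_pred0 // mul0r oppr0 expR0 mul1r.
  have {}IHi := IHi (ltnW iK); pose i' := Ordinal iK.
  have [e0 e1] := andP (eta01 i').
  set a := eta i' / (c * K%:R).
  (* The sign allows the induction hypothesis to be multiplied by [1 - a]; it holds because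
     [eta i' <= 1 <= c * K%:R]. *)
  have a1 : 0 <= 1 - a.
    rewrite subr_ge0 ler_pdivrMr // mul1r (le_trans e1) //.
    by apply: (le_trans c1); apply: ler_peMr; rewrite ?ler1n // ltW.
  have -> : \sum_(j < K | (j < i.+1)%N) eta j =
      eta i' + \sum_(j < K | (j < i)%N) eta j.
    rewrite (bigD1 i') /=; last exact: ltnSn.
    congr (_ + _); apply: eq_bigl => j.
    by rewrite -val_eqE /= ltnS andbC -ltn_neqAle.
  rewrite mulrDl opprD expRD -/a -mulrA.
  apply: (@le_trans _ _ ((1 - a) * (f O - f (selected sel i)))); last first.
    apply: (le_trans (ler_wpM2l a1 IHi)).
    by rewrite ler_wpM2r ?mulr_ge0 ?expR_ge0 // expR_ge1Dx.
  (* A greedy index exists: at most [i < K] indices are taken, and [K = #|O|] is at most the number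
     of sensors. *)
  have [|g gP] := @argmax_exists (~: selected sel i)%SET
      (marginal_gain f (selected sel i)).
    rewrite -(ltn_add2l #|selected sel i|) cardsC addn0.
    apply: (leq_trans (leq_ltn_trans (card_selected sel i) iK)).
    by rewrite -OK; exact: max_card.
  (* Writing the new value as the old one plus [eta i'] times the greedy gain reduces the step to
     [max_gain_ge], scaled by [eta i']. *)
  have := geta i' g gP; rewrite /= {1}/marginal_gain => /(canRL (subrK _)) ->.
  rewrite opprD addrCA addrC mulrBl mul1r lerD2l lerN2 /a mulrAC ler_pdivrMr //.
  rewrite -[X in _ <= X]mulrA; apply: ler_wpM2l => //; rewrite mulrC -OK.
  exact: max_gain_ge.
rewrite mulrBl mul1r lerBlDr addrC -lerBlDr (le_trans (step K _)) //.
rewrite ler_wpM2r // ler_expR lerN2 ler_pdivlMr // mulrA -[x / c * c]mulrA.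
rewrite mulVf ?gt_eqF // mulr1 (le_trans xeta) // le_eqVlt; apply/orP; left.
by apply/eqP/eq_bigl => j; rewrite ltn_ord.
Qed.
End Curvature.

(** * Exponential moments by discretization *)

(** An affine bound, so that expectations can be taken termwise. It comes from exp(-t) <= 1/(1+t) =
    1 - t/(1+t) at t = qy, with the last denominator enlarged to 1 + q. *)
Lemma expRN_le (R : realType) (q y : R) : 0 <= q -> 0 <= y <= 1 ->
  expR (- (q * y)) <= 1 - q / (1 + q) * y.
Proof.
move=> q0 /andP[y0 y1]; have qy0 : 0 <= q * y by rewrite mulr_ge0.
apply: (@le_trans _ _ (1 + q * y)^-1).
  by rewrite expRN lef_pV2 ?posrE ?expR_gt0 ?expR_ge1Dx //; lra.
have -> : (1 + q * y)^-1 = 1 - q * y / (1 + q * y) by field; lra.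
rewrite lerD2l lerN2 mulrAC ler_wpM2l // lef_pV2 ?posrE; last 2 first.
- lra.
- lra.
by rewrite lerD2l ler_piMr.
Qed.

(** Half-open intervals make the bins disjoint. The value 1 falls into bin [N], so the unit interval
    needs [N.+1] bins. *)
Definition bin (R : realType) (N k : nat) : set R :=
  `[k%:R / N%:R, k.+1%:R / N%:R[%classic.

Lemma bin_exists (R : realType) (N : nat) (x : R) : (0 < N)%N -> 0 <= x <= 1 ->
  exists k : 'I_N.+1, bin N k x.
Proof.
move=> N0 /andP[x0 x1]; have N0' : 0 < N%:R :> R by rewrite ltr0n.
have xN0 : 0 <= x * N%:R by rewrite mulr_ge0 // ltW.
have /andP[tx xt] := Num.Theory.trunc_itv xN0.
have tN : (Num.Def.trunc (x * N%:R) < N.+1)%N.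
  by rewrite ltnS -(ler_nat R) (le_trans tx) // ler_piMl // ltW.
exists (Ordinal tN); rewrite /bin /= in_itv /=.
by rewrite ler_pdivrMr // tx ltr_pdivlMr.
Qed.

Lemma bin_inj (R : realType) (N k l : nat) (x : R) :
  bin N k x -> bin N l x -> k = l.
Proof.
wlog kl : k l / (k <= l)%N => [hw kx lx|].
  by have [/hw|/ltnW /hw] := leqP k l; [|move/(_ lx kx)]; auto.
rewrite /bin /= !in_itv /= => /andP[_ xk] /andP[lx _].
(* For [N = 0] both endpoints are 0, the inverse of 0 being 0, so the bin is empty. *)
have := le_lt_trans lx xk; case: N xk lx => [|N] xk lx.
  by rewrite !invr0 !mulr0 ltxx.
rewrite ltr_pM2r ?invr_gt0 ?ltr0n // ltr_nat ltnS => lk.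
by apply/eqP; rewrite eqn_leq kl.
Qed.

Section Discretization.
Context (R : realType) (d : measure_display) (Omega : measurableType d).
Variables (Pr : probability Omega R) (X : {RV Pr >-> R}) (N : nat).
Hypotheses (N0 : (0 < N)%N) (X01 : forall w, 0 <= X w <= 1).
Local Notation level := (fun k : 'I_N.+1 => X @^-1` bin N k).
Local Notation p := (fun k : 'I_N.+1 => fine (Pr (X @^-1` bin N k))).

Lemma measurable_level (k : nat) : measurable (X @^-1` bin N k).
Proof.
rewrite -[_ @^-1` _]setTI; apply: measurable_funP => //.
exact: measurable_itv.
Qed.

Lemma level_trivIset D : trivIset D level.
Proof.
by move=> k l _ _ [w [kw lw]]; apply/val_inj/(bin_inj kw lw).
Qed.

Lemma level_cover : setT = \big[setU/set0]_k level k.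
Proof.
apply/esym; rewrite -subTset => w _.
have [k kw] := bin_exists N0 (X01 w).
by rewrite -bigcup_seq; exists k; rewrite //= mem_index_enum.
Qed.

Lemma level_sum1 : \sum_k p k = 1.
Proof.
apply: EFin_inj; rewrite -sumEFin -(probability_setT Pr) level_cover.
rewrite measure_bigsetU_ord; last 2 first.
- by move=> k; exact: measurable_level.
- exact: level_trivIset.
by apply: eq_bigr => k _; rewrite fineK // fin_num_measure //; exact: measurable_level.
Qed.

(** On each level set [X] lies below the right endpoint of its bin, so rounding up bounds the
    integral piece by piece. *)
Lemma expectation_le_level :
  ('E_Pr[X] <= (\sum_(k < N.+1) k.+1%:R / N%:R * p k)%:E)%E.
Proof.
rewrite expectation_def level_cover ge0_integral_bigsetU; last 5 first.
- by move=> k; exact: measurable_level.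
- exact: index_enum_uniq.
- exact: level_trivIset.
- rewrite -level_cover; apply/measurable_realfun.measurable_EFinP.
  exact: measurable_funP.
- by move=> w _; rewrite lee_fin; have /andP[] := X01 w.
rewrite -sumEFin; apply: lee_sum => k _.
have mk := measurable_level k.
rewrite EFinM fineK ?fin_num_measure // -integral_cst //.
apply: ge0_le_integral => //.
- by move=> w _; rewrite lee_fin; have /andP[] := X01 w.
- apply/measurable_realfun.measurable_EFinP; apply: measurable_funTS.
  exact: measurable_funP.
- by move=> w; rewrite /bin /= in_itv /= lee_fin => /andP[_ /ltW].
Qed.

(** The left side is the exponential moment of [X] rounded down. Rounding up and down differ by 1/N,
    so the rounded variable has mean at least mu - 1/N; [expRN_le] and 1 + t <= exp(t) do the
    rest. *)
Lemma level_mgf (q mu : R) : 0 <= q -> (mu%:E <= 'E_Pr[X])%E ->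
  \sum_(k < N.+1) expR (- (q * (k%:R / N%:R))) * p k <=
    expR (- (q / (1 + q) * (mu - N%:R^-1))).
Proof.
move=> q0 /le_trans /(_ expectation_le_level); rewrite lee_fin => mule.
have N0' : 0 < N%:R :> R by rewrite ltr0n.
apply: le_trans (expR_ge1Dx _).
apply: (@le_trans _ _ (\sum_(k < N.+1) (1 - q / (1 + q) * (k%:R / N%:R)) * p k)).
  apply: ler_sum => k _; apply: ler_wpM2r; first exact: fine_ge0.
  apply: expRN_le => //; rewrite divr_ge0 ?ler0n //= ler_pdivrMr // mul1r ler_nat.
  by rewrite -ltnS.
have -> : \sum_(k < N.+1) (1 - q / (1 + q) * (k%:R / N%:R)) * p k =
    1 - q / (1 + q) * (\sum_(k < N.+1) k.+1%:R / N%:R * p k - N%:R^-1).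
  have NE : N%:R^-1 = \sum_(k < N.+1) N%:R^-1 * p k.
    by rewrite -mulr_sumr level_sum1 mulr1.
  rewrite [X in _ * (_ - X)]NE -sumrB mulr_sumr -[X in X - _]level_sum1 -sumrB.
  by apply: eq_bigr => k _; rewrite -natr1; ring.
rewrite lerD2l lerN2 ler_wpM2l ?lerD2r //.
by rewrite divr_ge0 // addr_ge0.
Qed.

End Discretization.

(** * Chernoff bound for the lower tail *)

Definition chernoff_rate (R : realType) (mu q : R) : R :=
  q ^+ 3 * mu / (2 * (1 + q)).

(** In the application [G] is the event that the performance guarantee holds; a large sum of ratios
    is only a sufficient condition for it. *)
Lemma chernoff_lower_tail (R : realType) (d : measure_display)
    (Omega : measurableType d) (Pr : probability Omega R) (K : nat)
    (X : 'I_K -> {RV Pr >-> R}) (mu q : R) (G : set Omega) :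
  (forall i w, 0 <= X i w <= 1) -> (forall i, (mu%:E <= 'E_Pr[X i])%E) ->
  mutually_independent Pr (fun i => X i : Omega -> R) ->
  0 < mu -> 0 < q < 1 ->
  measurable G -> [set w | (1 - q) * mu * K%:R <= \sum_i X i w] `<=` G ->
  ((1 - expR (- (chernoff_rate mu q * K%:R)))%:E <= Pr G)%E.
Proof.
move=> X01 muX indep mu0 /andP[q0 q1] mG XG.
have e0 : 0 < q ^+ 2 * mu / 2 by rewrite divr_gt0 // mulr_gt0 // exprn_gt0.
pose N := (Num.Def.trunc (q ^+ 2 * mu / 2)^-1).+1.
have N0 : (0 < N)%N by [].
have Ne : N%:R^-1 <= q ^+ 2 * mu / 2.
  rewrite -[leRHS]invrK lef_pV2 ?posrE ?invr_gt0 ?ltr0n //.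
  exact/ltW/truncnS_gt.
pose p i (k : 'I_N.+1) := fine (Pr (X i @^-1` bin N k)).
pose low (k : {ffun 'I_K -> 'I_N.+1}) :=
  \sum_i (k i)%:R / N%:R < (1 - q) * mu * K%:R.
pose cell (k : {ffun 'I_K -> 'I_N.+1}) := \bigcap_(i in setT) (X i @^-1` bin N (k i)).
have mcell k : measurable (cell k).
  by apply: fin_bigcap_measurable => // i _; exact: measurable_level.
have Prcell k : Pr (cell k) = (\prod_i p i (k i))%:E.
  (* Independence is used for the full index set only: a cell fixes the bin of every [X i]. *)
  have -> : cell k = \bigcap_(i in [set` [set: 'I_K]%SET]) (X i @^-1` bin N (k i)).
    by apply: eq_bigcapl; split=> i _ //=; rewrite finset.in_setT.
  rewrite (indep _ (fun i => bin N (k i))); last by move=> i; exact: measurable_itv.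
  rewrite -prodEFin; apply: eq_big => [i|i _]; first by rewrite finset.in_setT.
  by rewrite fineK // fin_num_measure //; exact: measurable_level.
(* Outside [G] the sum is small, and rounding down only lowers it, so the point lies in a low
   cell. *)
have GC : ~` G `<=` \bigcup_(k in [set` low]) cell k.
  move=> w Gw; have bw i := bin_exists N0 (X01 i w).
  have [k kP] := choice bw.
  exists [ffun i => k i]; last by move=> i _; rewrite /= ffunE.
  change (is_true (low [ffun i => k i])); rewrite /low ltNge.
  apply/negP => lk; apply: Gw; apply: XG => /=.
  apply: (le_trans lk); apply: ler_sum => i _; rewrite ffunE.
  by have := kP i; rewrite /bin /= in_itv /= => /andP[].
have PGC : (Pr (~` G) <= (\sum_(k | low k) \prod_i p i (k i))%:E)%E.
  apply: (le_trans (content_sub_fsum Pr _ _ _ GC)) => //.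
  - exact: measurableC.
  - rewrite -(bigfs _ (index_enum_uniq _)) => [|k _]; last by rewrite mem_index_enum.
    rewrite -sumEFin; apply: lee_sum => k _.
    by rewrite -(Prcell k); exact: lexx.
suff PK : \sum_(k | low k) \prod_i p i (k i) <= expR (- (chernoff_rate mu q * K%:R)).
  rewrite -[G]setCK probability_setC; last exact: measurableC.
  rewrite EFinB; apply: leeB => //.
  by apply: (le_trans PGC); rewrite lee_fin.
have p0 i k : 0 <= p i k by exact: fine_ge0.
pose u : R := q * ((1 - q) * mu * K%:R).
(* The exponential Markov weight: at least 1 on low cells and nonnegative on all others, so the sum
   can be extended to all cells, where it factors over the coordinates. *)
pose tilt (k : {ffun 'I_K -> 'I_N.+1}) := expR (u - q * (\sum_i (k i)%:R / N%:R)).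
have prodp0 (k : {ffun 'I_K -> 'I_N.+1}) : 0 <= \prod_i p i (k i).
  by apply: prodr_ge0 => i _.
apply: (@le_trans _ _ (\sum_k tilt k * \prod_i p i (k i))).
  rewrite [leLHS]big_mkcond /=; apply: ler_sum => k _; case: ifPn => [kl|_].
    rewrite ler_peMl //; apply: le_trans (expR_ge1Dx _).
    by rewrite lerDl subr_ge0 /u ler_wpM2l // ltW.
  by rewrite mulr_ge0 ?expR_ge0.
have -> : \sum_k tilt k * \prod_i p i (k i) =
    expR u * \prod_(i < K) \sum_(k < N.+1) expR (- (q * (k%:R / N%:R))) * p i k.
  rewrite bigA_distr_bigA mulr_sumr; apply: eq_bigr => k _.
  rewrite /tilt expRD -mulrA; congr (_ * _).
  by rewrite mulr_sumr -sumrN expR_sum -big_split.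
apply: (@le_trans _ _ (expR u * \prod_(i < K) expR (- (q / (1 + q) * (mu - N%:R^-1))))).
  rewrite ler_wpM2l ?expR_ge0 //; apply: ler_prod => i _; apply/andP; split.
    by apply: sumr_ge0 => k _; rewrite mulr_ge0 ?expR_ge0.
  by apply: level_mgf => //; exact: ltW.
rewrite -expR_sum -expRD ler_expR sumr_const card_ord -[_ *+ K]mulr_natr.
rewrite /u /chernoff_rate -subr_ge0; set e := N%:R^-1 in Ne *.
(* Without rounding the exponent per iteration would be q^3 mu / (1 + q), since (1 - q)(1 + q) = 1 -
   q^2. The bound on [e] gives up at most half of it. *)
have -> : - (q ^+ 3 * mu / (2 * (1 + q)) * K%:R) -
      (q * ((1 - q) * mu * K%:R) + - (q / (1 + q) * (mu - e)) * K%:R) =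
    q / (1 + q) * (q ^+ 2 * mu / 2 - e) * K%:R by field; lra.
by rewrite !mulr_ge0 ?subr_ge0 // ?invr_ge0; lra.
Qed.

(** * Measurability of the output and the final assembly *)

(** Induction on [K] with [Q] general: fixing the last index [j], of which there are finitely many,
    turns [Q] into a condition on the previous set. *)
Lemma measurable_selected (d : measure_display) (Omega : measurableType d)
    (n K : nat) (sel : Omega -> nat -> 'I_n) :
  (forall i j, (i < K)%N -> measurable [set w | sel w i = j]) ->
  forall Q : set {set 'I_n}, measurable [set w | Q (selected (sel w) K)].
Proof.
move=> msel Q; elim: K msel Q => [|K IHK] msel Q /=.
  have [Q0|nQ0] := pselect (Q finset.set0).
    by rewrite (_ : [set _ | _] = setT) //; apply/seteqP; split=> // w _.
  by rewrite (_ : [set _ | _] = set0) //; apply/seteqP; split=> // w /nQ0.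
rewrite (_ : [set _ | _] = \bigcup_(j in setT)
    ([set w | sel w K = j] `&` [set w | Q (j |: selected (sel w) K)])).
  apply: fin_bigcup_measurable => // j _; apply: measurableI; first exact: msel.
  apply: (IHK _ (fun S => Q (j |: S))) => i l iK; apply: msel.
  exact: ltn_trans iK (ltnSn K).
apply/seteqP; split=> w /= => [Qw|[j _ [<-]] //].
by exists (sel w K).
Qed.

(* C may depend on q, eps, lmin, mumin only: not on K, n, or the instance. *)
Theorem theorem3 (R : realType) (eps lmin mumin : R) :
  exists C : R -> R, (forall q, 0 < q < 1 -> 0 < C q) /\
  forall (m n K : nat) (Time : Type)
    (P : Time -> 'M[R]_m) (h : Time -> 'I_n -> 'cV[R]_m)
    (sigma2 : Time -> 'I_n -> R)
    (d : measure_display) (Omega : measurableType d) (Pr : probability Omega R)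
    (smp : Time -> Omega -> nat -> {set 'I_n})
    (sel : Time -> Omega -> nat -> 'I_n)
    (O : Time -> {set 'I_n})
    (eta : Time -> 'I_K -> {RV Pr >-> R})
    (ell mu : Time -> 'I_K -> R),
  let f := fun k => mse_reduction (P k) (h k) (sigma2 k) in
  let c := fun k => Num.max (max_curvature (f k)) 1 in
  (forall k, sympd (P k)) ->
  (forall k i, 0 < sigma2 k i) ->
  (0 < K)%N ->
  expR (- K%:R) <= eps < 1 ->
  (forall k, randomized_greedy Pr K eps (f k) (smp k) (sel k)) ->
  (forall k, is_optimum (f k) K (O k)) ->
  (forall k, is_gain_ratio (f k) (sel k) (fun i => eta k i : Omega -> R)) ->
  (forall k i, 0 < ell k i) ->
  (forall k i w, ell k i <= eta k i w <= 1) ->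
  (forall k i, ('E_Pr[eta k i] = (mu k i)%:E)%E) ->
  is_min (fun ki : Time * 'I_K => ell ki.1 ki.2) lmin ->
  is_min (fun ki : Time * 'I_K => mu ki.1 ki.2) mumin ->
  (forall k w,
     (1 - expR (- (lmin / c k))) * f k (O k) <= f k (selected (sel k w) K)) /\
  (forall k, mutually_independent Pr (fun i => eta k i : Omega -> R) ->
     forall q, 0 < q < 1 ->
     ((1 - expR (- (C q * K%:R)))%:E <=
        Pr [set w | ((1 - expR (- ((1 - q) * mumin / c k))) * f k (O k)
                       <= f k (selected (sel k w) K))%R])%E).
Proof.
(* [C] is chosen before the hypotheses that force [mumin] to be positive are available, hence the
   dummy value 1. *)
exists (fun q => if 0 < mumin then chernoff_rate mumin q else 1); split.
  move=> q /andP[q0 q1]; case: ifP => // mumin0.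
  by rewrite divr_gt0 ?mulr_gt0 ?exprn_gt0 //; lra.
move=> m n K Time P h sigma2 d Omega Pr smp sel O eta ell mu f c.
move=> Ppd sigma20 K0 _ rg Oopt gain_ratio ell0 eta_itv Eeta [[ki0 _] lmin_le].
move=> [[[k1 i1] /= mumin_eq] mumin_le].
have eta01 k i w : 0 <= eta k i w <= 1.
  by have /andP[le ->] := eta_itv k i w; rewrite andbT (le_trans _ le) // ltW.
(* The minimum is attained at [(k1, i1)], where the mean is at least the positive lower bound
   [ell k1 i1]. *)
have mumin0 : 0 < mumin.
  rewrite -mumin_eq; apply: (lt_le_trans (ell0 k1 i1)).
  rewrite -lee_fin -Eeta -[leLHS](expectation_cst Pr); apply: expectation_le => //.
  - by move=> w; exact: ltW (ell0 k1 i1).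
  - by move=> w; have /andP[] := eta01 k1 i1 w.
  - by apply: aeW => w; have /andP[] := eta_itv k1 i1 w.
have gain_ge0 k (S : {set 'I_n}) i : i \notin S -> 0 <= marginal_gain (f k) S i.
  by move=> iS; exact: (mse_reduction_gain_ge0 (h k) (Ppd k) (sigma20 k) iS).1.
have gain_eq0 k (S T : {set 'I_n}) i : S \subset T -> i \notin T ->
    marginal_gain (f k) S i = 0 -> marginal_gain (f k) T i = 0.
  move=> ST iT; have iS : i \notin S by apply: contra iT; exact: (fintype.subsetP ST).
  have [_ gS] := mse_reduction_gain_ge0 (h k) (Ppd k) (sigma20 k) iS.
  have [_ gT] := mse_reduction_gain_ge0 (h k) (Ppd k) (sigma20 k) iT.
  by move/esym/eqP; rewrite gS -gT => /eqP.
(* The first claim takes [x = lmin], the second [x = (1 - q) * mumin] on the event supplied by the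
   Chernoff bound. *)
have bound k w x : x * K%:R <= \sum_i eta k i w ->
    (1 - expR (- (x / c k))) * f k (O k) <= f k (selected (sel k w) K).
  have [] := Oopt k; rewrite finset.inE => /eqP OK _.
  apply: (greedy_bound (@gain_ge0 k) (@gain_eq0 k)) => //.
  - exact: mse_reduction_set0.
  - by move=> i g; exact: (gain_ratio k w i g).
split=> [k w|k indep q q01].
  apply: bound; rewrite mulr_natr -[X in _ *+ X](card_ord K) -sumr_const.
  apply: ler_sum => i _; have /andP[le _] := eta_itv k i w.
  exact: le_trans (lmin_le (k, i)) le.
rewrite mumin0; apply: (chernoff_lower_tail (X := eta k)) => //.
- by move=> i; rewrite Eeta lee_fin; exact: (mumin_le (k, i)).
- apply: (measurable_selected (rg_sel_measurable (rg k))
    (fun S => (1 - expR (- ((1 - q) * mumin / c k))) * f k (O k) <= f k S)).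
- by move=> w; exact: bound.
Qed.
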